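(* Fix $\theta$. Let $K(\theta,s)=\sum_{j=0}^{m-1}K^j(\theta)(b_0s)^j$, $W(\theta,s)=\sum_{j=0}^{k-1}W^j(\theta)(bs)^j$ and $\widetilde W(\theta,s)$ be as in the context. Assume that the derivatives $\frac{d^i}{d\theta^i}K^j(W^0_1(\theta))$ (respectively $\frac{d^i}{d\theta^i}K^j(\widetilde W^0_1(\theta))$ for the composition with $\widetilde W$), $i=0,\dots,k-1$, $j=0,\dots,m-1$, are given as input. Then the computational complexity of computing the compositions $K\circ W(\theta,s)$ and $K\circ\widetilde W(\theta,s)$, as polynomials in $s$, using the table procedure described in the context, is $\Theta(mk^4)$, with space $\Omega(k^2)$.
   Context: Here $K^j:\mathbb R\to\mathbb R^2$ are $1$-periodic functions, $W=(W_1,W_2)$ takes values in $\mathbb R^2$, with $W^j$ $1$-periodic for $j\ge1$ and $W^0(\theta)-(\theta,0)$ $1$-periodic, and $b_0,b>0$ are scaling factors. Given real numbers $\omega>0$, $\lambda<0$ and a positive delay function $r$ on $\mathbb R^2$, $$\widetilde W(\theta,s)=W\bigl(\theta-\omega r(K(W(\theta,s))),\,s\,e^{-\lambda r(K(W(\theta,s)))}\bigr),$$ which is handled as a polynomial in $s$ truncated to $\sum_{j=0}^{k-1}\widetilde W^j(\theta)(bs)^j$. The compositions are computed as polynomials in $s$ truncated at degree $k-1$, via $$K\circ W(\theta,s)=\sum_{j=0}^{m-1}K^j(W_1(\theta,s))\,\bigl(b_0W_2(\theta,s)\bigr)^j,$$ evaluated by Horner's scheme ($m-1$ polynomial products and $m-1$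 polynomial sums) after the polynomials $K^j\circ W_1$ have been computed (componentwise) by the table procedure; likewise with $\widetilde W$ in place of $W$. Table procedure. For a periodic function $S$ and a polynomial $q(s)$ of degree $d$ (here $d=k-1$), with the derivatives $\frac{d^l}{d\theta^l}S(q(0))$, $0\le l\le d$, given, put $a_{11}=1$, $a_{i,1}=0$ for $i\ne1$, $a_{ij}=0$ for $j>i$, $a_{2,2}=\frac{d}{ds}q(s)$, and for $2\le j\le i\le d+1$ $$a_{ij}(s)=\frac1{i-1}\Bigl(\frac{d}{ds}a_{i-1,j}(s)+a_{i-1,j-1}(s)\frac{d}{ds}q(s)\Bigr),$$ row $i\ge 2$ being computed only up to degree $d+1-i$. The coefficients of $p=S\circ q$ up to order $d$ are $p_j=\sum_{l=0}^{d}a_{j+1,l+1}(0)\frac{d^l}{d\theta^l}S(q(0))$. Complexity counts real multiplications and additions; polynomial products are done by the classical (schoolbook) method. Space counts stored real coefficients. *)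

(* Defs.v *)
From HB Require Import structures.
From mathcomp Require Import all_boot all_order all_algebra.
From mathcomp Require Import all_classical all_reals all_analysis.
Import Order.TTheory GRing.Theory Num.Theory.
Import numFieldNormedType.Exports.
Set Implicit Arguments.
Unset Strict Implicit.
Unset Printing Implicit Defensive.
Local Open Scope classical_set_scope.
Local Open Scope ring_scope.

(** * Cost model

   A program over the reals, with the value it returns, the number of real
   additions and multiplications it performs ([ops]), and the largest number of
   real coefficients it stores at the same time ([peak]), not counting its
   read-only input.  Only [addM] and [mulM] increase [ops].  Storage follows the
   lexical scope: a value bound by [let*] occupies memory until the end of the
   scope, and [loopM] overwrites its state at each iteration. *)

Class Stored (A : Type) := ncoefs : A -> nat.
#[global] Instance stored_real (R : realType) : Stored R := fun _ => 1%N.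
#[global] Instance stored_seq (A : Type) (sA : Stored A) : Stored (seq A) :=
  fun s => sumn (map ncoefs s).
#[global] Instance stored_pair (A B : Type) (sA : Stored A) (sB : Stored B) :
  Stored (A * B)%type := fun x => (ncoefs x.1 + ncoefs x.2)%N.

Record prog (A : Type) := Prog { result : A; ops : nat; peak : nat }.

Definition ret {A : Type} (x : A) : prog A := Prog x 0 0.

Definition bind {A B : Type} {sA : Stored A} (c : prog A) (f : A -> prog B) :
    prog B :=
  let x := result c in
  Prog (result (f x)) (ops c + ops (f x))
       (maxn (peak c) (ncoefs x + peak (f x))).

Notation "'let*' x := c 'in' f" := (bind c (fun x => f))
  (at level 200, x name, c at level 200, f at level 200,
   format "'[v' 'let*'  x  :=  c  'in' '/' f ']'").

Fixpoint mapM {A B : Type} {sB : Stored B} (f : A -> prog B) (s : seq A) :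
    prog (seq B) :=
  if s is x :: s' then
    let* y := f x in let* ys := mapM f s' in ret (y :: ys)
  else ret [::].

(** [x] stays stored while [f i x] is computed, and is then replaced by it. *)
Fixpoint loopM {I A : Type} {sA : Stored A} (f : I -> A -> prog A) (s : seq I)
    (x : A) : prog A :=
  if s is i :: s' then
    let c := f i x in
    let c' := loopM f s' (result c) in
    Prog (result c') (ops c + ops c') (maxn (ncoefs x + peak c) (peak c'))
  else Prog x 0 (ncoefs x).

Section Programs.
Variable R : realType.

Definition addM (x y : R) : prog R := Prog (x + y) 1 0.
Definition mulM (x y : R) : prog R := Prog (x * y) 1 0.

(** The sum of [f l * g l] for [0 <= l <= n]. *)
Definition dotM (n : nat) (f g : nat -> R) : prog R :=
  let* t0 := mulM (f 0%N) (g 0%N) in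
  loopM (fun l acc => let* t := mulM (f l) (g l) in addM acc t) (iota 1 n) t0.

(** Polynomials in [s] are arrays of coefficients, lowest degree first, and are
   zero beyond their length.  The parameter [N] is the number of coefficients
   to be computed. *)
Definition paddM (N : nat) (p q : seq R) : prog (seq R) :=
  mapM (fun n => addM p`_n q`_n) (iota 0 N).
Definition pscaleM (N : nat) (c : R) (p : seq R) : prog (seq R) :=
  mapM (fun n => mulM c p`_n) (iota 0 N).
Definition pderivM (N : nat) (p : seq R) : prog (seq R) :=
  mapM (fun n => mulM n.+1%:R p`_n.+1) (iota 0 N).
Definition pmulM (N : nat) (p q : seq R) : prog (seq R) :=
  mapM (fun n => dotM n (fun l => p`_l) (fun l => q`_(n - l))) (iota 0 N).

(** Row [i] of the table is the array of the polynomials [a_{i1}, ..., a_{ii}],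
   so the column index is shifted by one; the entries that are identically zero
   are empty arrays.  Degree at most [d + 1 - i] means [d + 2 - i]
   coefficients. *)
Definition table_entryM (d : nat) (dq : seq R) (i : nat) (prev : seq (seq R))
    (j : nat) : prog (seq R) :=
  let N := (d + 2 - i)%N in
  let* u := pderivM N (nth [::] prev j.-1) in
  let* v := pmulM N (nth [::] prev j.-2) dq in
  let* w := paddM N u v in
  pscaleM N (i.-1)%:R^-1 w.

Definition table_rowM (d : nat) (dq : seq R) (i : nat) (prev : seq (seq R)) :
    prog (seq (seq R)) :=
  if i == 2%N then ret [:: [::]; dq]
  else let* es := mapM (table_entryM d dq i prev) (iota 2 i.-1) in
       ret ([::] :: es).

Definition table_coefM (d : nat) (row : seq (seq R)) (D : nat -> R) : prog R :=
  dotM d (fun l => (nth [::] row l)`_0) D.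

(** The coefficients of [S \o q] up to order [d], where [D l] is the [l]-th
   derivative of [S] at [q(0)].  Each row overwrites the previous one, once the
   coefficient of [S \o q] that depends on it has been computed. *)
Definition tableM (d : nat) (q : seq R) (D : nat -> R) : prog (seq R) :=
  let* dq := pderivM d q in
  let row1 := [:: [:: 1]] in
  let* p0 := table_coefM d row1 D in
  let* st := loopM (fun i st =>
      let* row := table_rowM d dq i st.1 in
      let* c := table_coefM d row D in
      ret (row, rcons st.2 c)) (iota 2 d) (row1, [:: p0]) in
  ret st.2.

(** The sum of the [P_j * V ^ j], where [P_j] is the [j]-th entry of [Ps]. *)
Definition hornerM (k : nat) (V : seq R) (Ps : seq (seq R)) : prog (seq R) :=
  if rev Ps is H0 :: rest then
    loopM (fun P H => let* HV := pmulM k H V in paddM k HV P) rest H0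
  else ret [::].

(** One component of the composition: [D j] lists the derivatives of the
   corresponding component of [K^j], and [V] is [b0 * w2]. *)
Definition compose1M (m k : nat) (V w1 : seq R) (D : nat -> nat -> R) :
    prog (seq R) :=
  let* Ps := mapM (fun j => tableM k.-1 w1 (D j)) (iota 0 m) in
  hornerM k V Ps.

Definition composeM (m k : nat) (b0 : R) (w1 w2 : seq R)
    (D : nat -> nat -> R * R) : prog (seq R * seq R) :=
  let* V := pscaleM k b0 w2 in
  let* x := compose1M m k V w1 (fun j i => (D j i).1) in
  let* y := compose1M m k V w1 (fun j i => (D j i).2) in
  ret (x, y).

(** * The functions *)

Definition periodic1 (T : Type) (f : R -> T) := forall x, f (x + 1) = f x.

(** [(theta, s) |-> \sum_(j < n) F^j(theta) (c s)^j] *)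
Definition series2 (n : nat) (c : R) (F : nat -> R -> R * R) (theta s : R) :
    R * R :=
  \sum_(j < n) (c * s) ^+ j *: F j theta.

Definition Kfun (m : nat) (b0 : R) (K : nat -> R -> R * R) (x : R * R) : R * R :=
  series2 m b0 K x.1 x.2.

Definition Wtilde (m k : nat) (b0 b omega lambda : R) (r : R * R -> R)
    (K W : nat -> R -> R * R) (theta s : R) : R * R :=
  let rho := r (Kfun m b0 K (series2 k b W theta s)) in
  series2 k b W (theta - omega * rho) (s * expR (- (lambda * rho))).

Definition taylor (n : nat) (f : R -> R) : R := derive1n n f 0 / n`!%:R.

(** The coefficient of [(b s)^j] in the expansion of [Wtilde] in powers of
   [b s]. *)
Definition Wtilde_coef (m k : nat) (b0 b omega lambda : R) (r : R * R -> R)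
    (K W : nat -> R -> R * R) (j : nat) (theta : R) : R * R :=
  let f := Wtilde m k b0 b omega lambda r K W theta in
  (taylor j (fun s => (f s).1) / b ^+ j, taylor j (fun s => (f s).2) / b ^+ j).

(** The coefficients in [s] of [series2 k b F theta]. *)
Definition coefs1 (k : nat) (b : R) (F : nat -> R -> R * R) (theta : R) :
    seq R := mkseq (fun j => (F j theta).1 * b ^+ j) k.
Definition coefs2 (k : nat) (b : R) (F : nat -> R -> R * R) (theta : R) :
    seq R := mkseq (fun j => (F j theta).2 * b ^+ j) k.

(** [D i] is the [i]-th derivative of [f] at [x] for [i < k].  As [derive1n] is
   total, existence is required separately: the derivatives of order less than
   [k.-1] exist around [x], and the one of order [k.-1] exists at [x]. *)
Definition derivatives_at (k : nat) (f : R -> R) (x : R) (D : nat -> R) : Prop :=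
  [/\ forall i, (i.+2 < k)%N -> \forall y \near x, derivable (derive1n i f) y 1,
      forall i, (i.+1 < k)%N -> derivable (derive1n i f) x 1
    & forall i, (i < k)%N -> D i = derive1n i f x].

End Programs.

(* Main.v *)
Require Import Defs.
From HB Require Import structures.
From mathcomp Require Import all_boot all_order all_algebra.
From mathcomp Require Import all_classical all_reals all_analysis.
From mathcomp Require Import zify lra.
Import Order.TTheory GRing.Theory Num.Theory.
Import numFieldNormedType.Exports.
Set Implicit Arguments.
Unset Strict Implicit.
Unset Printing Implicit Defensive.
Local Open Scope classical_set_scope.
Local Open Scope ring_scope.

(** The correctness claim and the two cost claims are independent.

   Correctness.  Let [S] be a component of some [K j].  Write [q] for the first
   coordinate of the inner series, [u] for [q - q(0)], and [P] for the
   polynomial of degree less than [k] whose derivatives at [0] are the given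
   derivatives of [S] at [q(0)].  Up to order
   [k - 1] the function [S \o q] has the same Taylor coefficients at [0] as the
   polynomial [P \Po u], although [S] is differentiable only finitely often.
   The predicate [jet] makes this precise; it is compatible with sums, products
   ([jetM]) and substitution of a polynomial ([jet_comp]), so the composition
   [K \o W] has a jet that is a polynomial expression in the [P \Po u] and the
   second coordinate.  What remains is algebra of polynomials: the recursion of
   the table is the chain rule applied [n] times to [P \Po u]
   ([derivn_comp_table]), the entries being scaled so that the coefficient of
   order [n] can be read off at [0], and Horner's scheme commutes with
   truncation because a coefficient of a product depends only on coefficients
   of at most the same order ([pmulM_result]).  That the rows become shorter is
   harmless: each row is differentiated once to give the next, and this costs
   one order.

   Operations.  The number of operations does not depend on the data.  Row [i]
   of a table, for [i > 2], consists of [i - 1] computed entries, each requiring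
   one product of polynomials with [k + 1 - i] coefficients, hence about
   [(k - i)^2] operations, and [\sum_i i (k - i)^2] is of order [k^4].  There
   are [2 m] tables; Horner's scheme adds only [O(m k^2)].  The closed form
   [sum_entry_costs] gives the lower bound.

   Space.  Row [a + 1] of a table holds [a] polynomials with [k - a]
   coefficients, so that the row in the middle occupies about [k^2 / 4]
   places. *)

(** * Jets of finitely differentiable functions *)

Section Jets.
Variable R : realType.
Implicit Types (n i : nat) (f g S : R -> R) (x : R) (p q P : {poly R}).

(** The function [f] is [n] times differentiable at [x], with the Taylor
   polynomial [p] in powers of [y - x] up to order [n]; only the first [n.+1]
   coefficients of [p] matter.  The recursion on the derivatives of [f] and [p]
   turns Leibniz' and Faa di Bruno's formulas into plain induction with the
   product rule and the chain rule.  Derivability near [x] is imposed only on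
   the derivatives that are to be differentiated again, so the last one exists
   at the single point [x], as in [derivatives_at]. *)
Fixpoint jet n f x p : Prop :=
  f x = p`_0 /\
  if n is n'.+1 then
    [/\ derivable f x 1,
        (0 < n')%N -> \forall y \near x, derivable f y 1
      & jet n' (derive1 f) x p^`()]
  else True.

Lemma jet_value n f x p : jet n f x p -> f x = p`_0.
Proof. by case: n => [|n] []. Qed.

Lemma near_eq_derive1 f g x : (\forall y \near x, f y = g y) ->
  derive1 f x = derive1 g x.
Proof. by move=> fg; rewrite !derive1E; exact: near_eq_derive. Qed.

(** A jet of order [0] only sees the value at [x], even when [x] is the only
   point where the two functions are known to agree.  The derivative of a
   product or a composition is known at [x] alone in this case, whence the
   guard on the second hypothesis. *)
Lemma jet_near_eq n f g x p : f x = g x ->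
    ((0 < n)%N -> \forall y \near x, f y = g y) ->
  jet n f x p -> jet n g x p.
Proof.
elim: n f g p => [|n IHn] f g p fgx fg /= [fx H]; split; rewrite -?fgx //.
have {}fg := fg isT; case: H => df df' jf.
(* The derivatives agree at all points near [x] because the functions agree
   around each of these points. *)
have fg2 : \forall y \near x, \forall z \near y, f z = g z by apply/near_join.
split.
- exact: near_eq_derivable df.
- move=> n_gt0; have := df' n_gt0.
  by apply: filterS2 fg2 => y fgy; apply: near_eq_derivable.
- apply: IHn jf; first exact: near_eq_derive1.
  by move=> _; apply: filterS fg2 => y; apply: near_eq_derive1.
Qed.

Lemma jetS n f x p : jet n.+1 f x p -> jet n f x p.
Proof.
elim: n f p => [|n IHn] f p; first by case.
move=> [fx [df df' jf]]; split; first exact: fx.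
split; [exact: df | by move=> _; exact: df' | exact: IHn].
Qed.

Lemma jet_cst n c x : jet n (fun=> c) x c%:P.
Proof.
elim: n c => [|n IHn] c /=; rewrite coefC; split=> //; split.
- exact: derivable_cst.
- by move=> _; near=> y; exact: derivable_cst.
- rewrite derivC -[0]/(0%:P).
  have -> : derive1 (fun=> c) = fun=> 0.
    by apply/funext => y; rewrite derive1_cst.
  exact: IHn.
Unshelve. all: by end_near. Qed.

Lemma jetD n f g x p q : jet n f x p -> jet n g x q ->
  jet n (fun y => f y + g y) x (p + q).
Proof.
have dD (h k : R -> R) y : derivable h y 1 -> derivable k y 1 ->
    derivable (fun z => h z + k z) y 1 /\
    derive1 (fun z => h z + k z) y = derive1 h y + derive1 k y.
  move=> dh dk; have [E D] := is_deriveD (derivableP dh) (derivableP dk).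
  split; first exact: E.
  by rewrite !derive1E; exact: D.
elim: n f g p q => [|n IHn] f g p q /=.
  by case=> -> _ [-> _]; rewrite coefD.
case=> fx [df df' jf] [gx [dg dg' jg]]; split; first by rewrite coefD fx gx.
split.
- by have [] := dD _ _ _ df dg.
- move=> n0; have := dg' n0.
  by apply: filterS2 (df' n0) => y dfy dgy; have [] := dD _ _ _ dfy dgy.
- rewrite derivD; apply: jet_near_eq (IHn _ _ _ _ jf jg).
    by have [] := dD _ _ _ df dg.
  move=> n0; have := dg' n0.
  by apply: filterS2 (df' n0) => y dfy dgy; have [] := dD _ _ _ dfy dgy.
Qed.

(** By induction: the product rule writes the derivative of [f * g] as a sum of
   two products whose factors have jets of order [n]. *)
Lemma jetM n f g x p q : jet n f x p -> jet n g x q ->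
  jet n (fun y => f y * g y) x (p * q).
Proof.
have dM (h k : R -> R) y : derivable h y 1 -> derivable k y 1 ->
    derivable (fun z => h z * k z) y 1 /\
    derive1 (fun z => h z * k z) y = derive1 h y * k y + h y * derive1 k y.
  move=> dh dk; have [E D] := is_deriveM (derivableP dh) (derivableP dk).
  split; first exact: E.
  by rewrite !derive1E [LHS]D addrC [k y *: _]mulrC.
elim: n f g p q => [|n IHn] f g p q.
  by rewrite /= => -[-> _] [-> _]; rewrite coefM big_ord1.
move=> jf jg; have := (jf, jg) => /= -[[fx [df df' jdf]] [gx [dg dg' jdg]]].
split; first by rewrite coefM big_ord1 fx gx.
split.
- by have [] := dM _ _ _ df dg.
- move=> n0; have := dg' n0.
  by apply: filterS2 (df' n0) => y dfy dgy; have [] := dM _ _ _ dfy dgy.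
- rewrite derivM; apply: jet_near_eq
    (jetD (IHn _ _ _ _ jdf (jetS jg)) (IHn _ _ _ _ (jetS jf) jdg)).
    by have [] := dM _ _ _ df dg.
  move=> n0; have := dg' n0.
  by apply: filterS2 (df' n0) => y dfy dgy; have [] := dM _ _ _ dfy dgy.
Qed.

Lemma jet_sum n m x (f : nat -> R -> R) (p : nat -> {poly R}) :
    (forall j, (j < m)%N -> jet n (f j) x (p j)) ->
  jet n (fun y => \sum_(j < m) f j y) x (\sum_(j < m) p j).
Proof.
elim: m => [|m IHm] fp.
  have -> : (fun y => \sum_(j < 0) f j y) = fun=> 0.
    by apply/funext => y; rewrite big_ord0.
  by rewrite big_ord0 -polyC0; exact: jet_cst.
have -> : (fun y => \sum_(j < m.+1) f j y) =
    fun y => \sum_(j < m) f j y + f m y.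
  by apply/funext => y; rewrite big_ord_recr.
rewrite big_ord_recr; apply: jetD; last exact: fp.
by apply: IHm => j ltjm; apply: fp; exact: ltnW.
Qed.

Lemma jetX n f x p e : jet n f x p -> jet n (fun y => f y ^+ e) x (p ^+ e).
Proof.
move=> jf; elim: e => [|e IHe]; first exact: jet_cst.
have -> : (fun y => f y ^+ e.+1) = fun y => f y * f y ^+ e.
  by apply/funext => y; rewrite exprS.
by rewrite exprS; exact: jetM.
Qed.

Lemma jet_horner n p : jet n (horner p) 0 p.
Proof.
elim: n p => [|n IHn] p /=; rewrite horner_coef0; split=> //; split.
- exact: derivable_horner.
- by move=> _; near=> y; exact: derivable_horner.
- by rewrite -derivE; exact: IHn.
Unshelve. all: by end_near. Qed.

(** By induction: the derivative of [f \o q] is [(f' \o q) * q'], and the formal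
   substitution obeys the same rule.  The constant term of [q] is removed since
   [P] is an expansion around [q(0)]. *)
Lemma jet_comp n f q P : jet n f q`_0 P ->
  jet n (fun s => f q.[s]) 0 (P \Po (q - (q`_0)%:P)).
Proof.
have q0 : q.[0] = q`_0 by rewrite horner_coef0.
have q00 : (q - (q`_0)%:P).[0] = 0 by rewrite !hornerE q0 subrr.
have cmp0 (p : {poly R}) : (p \Po (q - (q`_0)%:P))`_0 = p`_0.
  by rewrite -[LHS]horner_coef0 horner_comp q00 horner_coef0.
have dq y : derivable (horner q) y 1 by exact: derivable_horner.
have dcomp (h : R -> R) y : derivable h q.[y] 1 ->
    derivable (fun s => h q.[s]) y 1 /\
    derive1 (fun s => h q.[s]) y = derive1 h q.[y] * q^`().[y].
  move=> dh; split; last by rewrite [LHS](derive1_comp (dq y) dh) derivE.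
  move/derivable1_diffP: (dq y) => dq'; move/derivable1_diffP: dh => dh'.
  by apply/derivable1_diffP; exact: differentiable_comp.
have nearq (A : R -> Prop) :
    (\forall y \near q`_0, A y) -> \forall s \near 0, A q.[s].
  rewrite -q0 => Aq.
  have /differentiable_continuous qc : differentiable (horner q) 0.
    exact/derivable1_diffP.
  exact: qc Aq.
elim: n f P => [|n IHn] f P /=; rewrite q0 cmp0; case=> fx; first by split.
case=> df df' jf; split; first exact: fx.
split.
- by apply: (dcomp _ _ _).1; rewrite q0.
- by move=> n0; apply: filterS (nearq _ (df' n0)) => s /dcomp[].
- rewrite deriv_comp derivB derivC subr0.
  apply: jet_near_eq (jetM (IHn _ _ jf) (jet_horner n q^`())).
    by rewrite (dcomp _ _ _).2 ?q0.
  by move=> n0; apply: filterS (nearq _ (df' n0)) => s /dcomp[].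
Qed.

Lemma derive1n_derive1 i f : derive1n i (derive1 f) = derive1n i.+1 f.
Proof. by rewrite /derive1n iterSr. Qed.

Lemma jet_derive1n n f x p i : jet n f x p -> (i <= n)%N ->
  derive1n i f x = p`_i *+ i`!.
Proof.
elim: n f p i => [|n IHn] f p [|i].
- by move=> /jet_value.
- by [].
- by move=> /jet_value.
- move=> [_ [_ _ jf]] le_in.
  by rewrite -derive1n_derive1 (IHn _ _ _ jf) // coef_deriv -mulrnA.
Qed.

Lemma taylor_jet n f p i : jet n f 0 p -> (i <= n)%N -> taylor i f = p`_i.
Proof.
move=> jf le_in; rewrite /taylor (jet_derive1n jf) //.
by rewrite -[p`_i *+ _]mulr_natr mulfK //.
Qed.

Lemma derivatives_at_jet n f x D p : derivatives_at n.+1 f x D ->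
  (forall i, (i <= n)%N -> D i = p`_i *+ i`!) -> jet n f x p.
Proof.
elim: n f D p => [|n IHn] f D p [H1 H2 H3] Dp.
  by split=> //; rewrite -[p`_0]mulr1n -(Dp 0) // H3.
split; first by rewrite -[p`_0]mulr1n -(Dp 0) // H3.
split; [exact: (H2 0) | by move=> n0; apply: (H1 0) |].
apply: (IHn _ (fun i => D i.+1)) => [|i le_in].
  split=> i lt_in; rewrite derive1n_derive1.
  - exact: H1.
  - exact: H2.
  - exact: H3.
by rewrite Dp // coef_deriv -mulrnA.
Qed.

End Jets.

(** * The table of the chain rule *)

Section Table.
Variable R : realType.
Implicit Types (d n l i : nat) (q P V : {poly R}).

(** The entry [a_{n+1,l+1}] of the table, without truncation.  The first column
   needs no exception: the recursion makes it vanish below the first row. *)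
Fixpoint table_poly q n l : {poly R} :=
  if n is n'.+1 then
    n%:R^-1 *: ((table_poly q n' l)^`() +
                (if l is l'.+1 then table_poly q n' l' else 0) * q^`())
  else (l == 0%N)%:R.

Lemma table_poly_Sn0 q n : table_poly q n.+1 0 = 0.
Proof.
elim: n => [|n /= ->] /=; last by rewrite deriv0 mul0r addr0 scaler0.
by rewrite derivC mul0r addr0 scaler0.
Qed.

Lemma table_poly_gt q n l : (n < l)%N -> table_poly q n l = 0.
Proof.
elim: n l => [|n IHn] [|l] //= lt_nl.
by rewrite !IHn ?(ltnW lt_nl) // deriv0 mul0r addr0 scaler0.
Qed.

Lemma table_poly11 q : table_poly q 1 1 = q^`().
Proof. by rewrite /= derivC add0r mul1r invr1 scale1r. Qed.

(** Differentiating [a * (P^`(l) \Po u)] contributes [a'] to column [l] and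
   [a * u'] to column [l.+1], which is the recursion of the table; the division
   by the row number accounts for the factorial. *)
Lemma derivn_comp_table q P u n d : u^`() = q^`() -> (n <= d)%N ->
  (P \Po u)^`(n) =
    n`!%:R *: \sum_(l < d.+1) table_poly q n l * (P^`(l) \Po u).
Proof.
move=> du; elim: n d => [|n IHn] d le_nd.
  rewrite big_ord_recl /= big1 ?mul1r ?addr0 ?scale1r //.
  by move=> l _; rewrite mul0r.
rewrite derivnS (IHn d) ?(ltnW le_nd) // derivZ factS natrM -scalerA.
rewrite scalerA [_ * _%:R]mulrC -scalerA; congr (_ *: _).
have S_neq0 : n.+1%:R != 0 :> R by rewrite pnatr_eq0.
apply: (scalerI (a := n.+1%:R^-1)); first by rewrite invr_eq0.
rewrite scalerA mulVf // scale1r raddf_sum scaler_sumr /=.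
have -> : \sum_(l < d.+1) n.+1%:R^-1 *: (table_poly q n l * (P^`(l) \Po u))^`()
  = \sum_(l < d.+1) n.+1%:R^-1 *: ((table_poly q n l)^`() * (P^`(l) \Po u)) +
    \sum_(l < d.+1)
      n.+1%:R^-1 *: (table_poly q n l * q^`() * (P^`(l.+1) \Po u)).
  rewrite -big_split /=; apply: eq_bigr => l _.
  rewrite -scalerDr derivM deriv_comp du -derivnS.
  by rewrite [(_ \Po _) * q^`()]mulrC mulrA.
(* The term that would leave the table on the right vanishes since the row is
   lower triangular; the other ones shift by one column. *)
rewrite [X in _ + X]big_ord_recr /= table_poly_gt // !mul0r scaler0 addr0.
rewrite big_ord_recl [RHS]big_ord_recl /= -addrA; congr (_ + _).
  by rewrite mul0r addr0 scalerAl.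
rewrite -big_split /=; apply: eq_bigr => l _.
by rewrite -scalerDr -mulrDl scalerAl.
Qed.

(** [derivn_comp_table] evaluated at [0], where [P^`(l) \Po u] becomes the
   [l]-th derivative of [P] at [0]. *)
Lemma coef_comp_table q P n d : (n <= d)%N ->
  (P \Po (q - (q`_0)%:P))`_n =
    \sum_(l < d.+1) (table_poly q n l)`_0 * (P`_l *+ l`!).
Proof.
move=> le_nd; set u := q - _.
have u0 : u.[0] = 0 by rewrite /u !hornerE horner_coef0 subrr.
have fact_neq0 : n`!%:R != 0 :> R by rewrite pnatr_eq0 -lt0n fact_gt0.
have du : u^`() = q^`() by rewrite /u derivB derivC subr0.
have /(congr1 (fun p : {poly R} => p`_0)) := derivn_comp_table P du le_nd.
rewrite coef_derivn addn0 ffactnn -[_ *+ _]mulr_natl coefZ.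
move=> /(mulfI fact_neq0) ->; rewrite coef_sum; apply: eq_bigr => l _.
rewrite -!horner_coef0 hornerM horner_comp u0 !horner_coef0.
by rewrite coef_derivn addn0 ffactnn.
Qed.

End Table.

#[local] Arguments table_poly : simpl never.

(** * What the programs compute *)

Section Results.
Variable R : realType.
Implicit Types (k d n l i j : nat) (p q P V : {poly R}).

Lemma loopM_result I A (sA : Stored A) (f : I -> A -> prog A) s x :
  result (loopM f s x) = foldl (fun y a => result (f a y)) x s.
Proof. by elim: s x => //= a s IHs x; rewrite IHs. Qed.

Lemma mapM_result A B (sB : Stored B) (f : A -> prog B) s :
  result (mapM f s) = [seq result (f x) | x <- s].
Proof. by elim: s => //= x s ->. Qed.

Lemma dotM_result n (f g : nat -> R) :
  result (dotM n f g) = \sum_(l < n.+1) f l * g l.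
Proof.
rewrite /dotM /= loopM_result /=.
elim: n => [|n IHn]; first by rewrite big_ord1.
by rewrite -[X in iota _ X]addn1 iotaD foldl_cat IHn [RHS]big_ord_recr.
Qed.

Definition trunc k p : seq R := mkseq (fun i => p`_i) k.

Lemma nth_trunc k p i : (i < k)%N -> (trunc k p)`_i = p`_i.
Proof. exact: nth_mkseq. Qed.

(** The hypotheses of this lemma and of the next ones constrain the arrays only
   where the program reads them, since the rows of the table are longer than
   the polynomials computed from them. *)
Lemma pderivM_result k (s : seq R) p :
    (forall i, (i <= k)%N -> s`_i = p`_i) ->
  result (pderivM k s) = trunc k p^`().
Proof.
move=> sp; rewrite /pderivM mapM_result; apply/eq_in_map => i.
by rewrite mem_iota => /andP[_ ltik] /=; rewrite coef_deriv sp // mulr_natl.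
Qed.

Lemma paddM_result k (s t : seq R) p q :
    (forall i, (i < k)%N -> s`_i = p`_i) ->
    (forall i, (i < k)%N -> t`_i = q`_i) ->
  result (paddM k s t) = trunc k (p + q).
Proof.
move=> sp tq; rewrite /paddM mapM_result; apply/eq_in_map => i.
by rewrite mem_iota => /andP[_ ltik] /=; rewrite coefD sp ?tq.
Qed.

Lemma pscaleM_result k c (s : seq R) p :
    (forall i, (i < k)%N -> s`_i = p`_i) ->
  result (pscaleM k c s) = trunc k (c *: p).
Proof.
move=> sp; rewrite /pscaleM mapM_result; apply/eq_in_map => i.
by rewrite mem_iota => /andP[_ ltik] /=; rewrite coefZ sp.
Qed.

Lemma pmulM_result k (s t : seq R) p q :
    (forall i, (i < k)%N -> s`_i = p`_i) ->
    (forall i, (i < k)%N -> t`_i = q`_i) ->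
  result (pmulM k s t) = trunc k (p * q).
Proof.
move=> sp tq; rewrite /pmulM mapM_result; apply/eq_in_map => i.
rewrite mem_iota => /andP[_ ltik] /=; rewrite dotM_result coefM.
apply: eq_bigr => l _; rewrite sp ?tq //.
  exact: leq_ltn_trans (leq_subr _ _) ltik.
by rewrite (leq_trans (ltn_ord l)).
Qed.

(** The program for row [n.+1] is exact up to degree [d - n], the truncation of
   the algorithm.  The first row is stored as the single entry [1], the entries
   beyond the end of an array being zero. *)
Definition table_row_spec d q n (row : seq (seq R)) : Prop :=
  forall l i, (i + n <= d)%N -> (nth [::] row l)`_i = (table_poly q n l)`_i.

Lemma table_row1 d q : table_row_spec d q 0 [:: [:: 1]].
Proof.
move=> [|l] i _ /=; first by rewrite coef1; case: i => [|[|i]].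
by rewrite !nth_nil coef0.
Qed.

Lemma table_rowM_result d q n prev : (n < d)%N ->
    table_row_spec d q n prev ->
  table_row_spec d q n.+1
    (result (table_rowM d (trunc d q^`()) n.+2 prev)).
Proof.
move=> lt_nd prevP [|l] i le_id.
  rewrite table_poly_Sn0. rewrite [RHS]coef0 /table_rowM.
  by case: ifP => _ /=; rewrite nth_nil.
(* The second row is given instead of being computed by the recursion. *)
rewrite /table_rowM; case: ifP => [/eqP[n0]|_].
  rewrite n0 in le_id *; case: l => [|l].
    by rewrite table_poly11 nth_trunc //; lia.
  by rewrite table_poly_gt // [RHS]coef0 /= !nth_nil.
rewrite -[nth _ _ l.+1]/(nth [::]
  (result (mapM (table_entryM d (trunc d q^`()) n.+2 prev) (iota 2 n.+1))) l).
rewrite mapM_result.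
have [lt_ln|le_nl] := ltnP l n.+1; last first.
  rewrite table_poly_gt // [RHS]coef0 [nth [::] _ l]nth_default ?nth_nil //.
  by rewrite size_map size_iota.
rewrite (nth_map 0%N) ?size_iota // nth_iota // /table_entryM /=.
have Ni : (i < d + 2 - n.+2)%N by lia.
rewrite (@pscaleM_result _ _ _ ((table_poly q n l.+1)^`() +
  table_poly q n l * q^`())) ?nth_trunc // => {Ni le_id} {}i Ni.
rewrite (@paddM_result _ _ _ (table_poly q n l.+1)^`()
  (table_poly q n l * q^`())) ?nth_trunc // => {Ni} {}i Ni.
  by rewrite (@pderivM_result _ _ (table_poly q n l.+1)) ?nth_trunc //
    => {Ni} {}i Ni; apply: prevP; lia.
by rewrite (@pmulM_result _ _ _ (table_poly q n l) q^`()) ?nth_trunc //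
  => {Ni} {}i Ni; [apply: prevP | rewrite nth_trunc //]; lia.
Qed.

Lemma table_coefM_result d q n row (D : nat -> R) P : (n <= d)%N ->
    table_row_spec d q n row ->
    (forall l, (l <= d)%N -> D l = P`_l *+ l`!) ->
  result (table_coefM d row D) = (P \Po (q - (q`_0)%:P))`_n.
Proof.
move=> le_nd rowP DP; rewrite /table_coefM dotM_result.
rewrite (coef_comp_table _ _ le_nd).
by apply: eq_bigr => l _; rewrite rowP ?DP // -ltnS.
Qed.

(** The state of the loop after [n] steps is row [n.+1] together with the
   coefficients of order at most [n]. *)
Lemma tableM_result d q (D : nat -> R) P :
    (forall l, (l <= d)%N -> D l = P`_l *+ l`!) ->
  result (tableM d (trunc d.+1 q) D) = trunc d.+1 (P \Po (q - (q`_0)%:P)).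
Proof.
move=> DP; rewrite /tableM /= loopM_result.
rewrite (@pderivM_result _ _ q); last by move=> i le_id; rewrite nth_trunc.
rewrite (table_coefM_result (leq0n d) (@table_row1 d q) DP).
set st0 := (_, _); set step := fun y a => _.
have inv n : (n <= d)%N -> let st := foldl step st0 (iota 2 n) in
    table_row_spec d q n st.1 /\
    st.2 = trunc n.+1 (P \Po (q - (q`_0)%:P)).
  elim: n => [_|n IHn lt_nd]; first by split=> //; exact: table_row1.
  rewrite -[X in iota _ X]addn1 iotaD foldl_cat /=.
  have [rowP coefsP] := IHn (ltnW lt_nd).
  have row'P := table_rowM_result lt_nd rowP.
  rewrite add2n; split=> //.
  by rewrite [RHS]mkseqS -/(trunc _ _) -coefsP
    -(table_coefM_result lt_nd row'P DP).
by have [_ ->] := inv d (leqnn d).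
Qed.

Lemma hornerM_result k m V (P : nat -> {poly R}) : (0 < m)%N ->
  result (Defs.hornerM k (trunc k V) [seq trunc k (P j) | j <- iota 0 m]) =
    trunc k (\sum_(j < m) P j * V ^+ j).
Proof.
move=> m_gt0; pose s := mkseq P m.
have -> : \sum_(j < m) P j * V ^+ j = horner_rec s V.
  rewrite -horner_Poly (@horner_coef_wide _ m); last first.
    by rewrite (leq_trans (size_Poly _)) // size_mkseq.
  by apply: eq_bigr => j _; rewrite coef_Poly nth_mkseq.
have -> : [seq trunc k (P j) | j <- iota 0 m] = map (trunc k) s.
  by rewrite -map_comp.
have : s != [::] by rewrite -size_eq0 size_mkseq -lt0n.
case/lastP: s => // s p _.
rewrite /Defs.hornerM map_rcons rev_rcons loopM_result -map_rev.
have -> : horner_rec (rcons s p) V = foldl (fun H P => H * V + P) p (rev s).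
  elim: s => [|p0 s IHs] /=; first by rewrite mul0r add0r.
  by rewrite rev_cons foldl_rcons IHs.
elim: (rev s) p => [|p1 s' IHs] p //=.
rewrite -IHs; congr foldl.
rewrite (@pmulM_result _ _ _ p V); try exact: nth_trunc.
by rewrite (@paddM_result _ _ _ (p * V) p1) //; exact: nth_trunc.
Qed.

(** The program returns the truncation of [\sum_j (P_j \Po u) * V ^ j], where
   [P_j] is the Taylor polynomial of [K j] at [w1(0)], and this polynomial is a
   jet of the composite function. *)
Lemma compose1M_result m d (b0 : R) (w1 w2 : {poly R}) (K : nat -> R -> R)
    (D : nat -> nat -> R) : (0 < m)%N ->
    (forall j, (j < m)%N -> derivatives_at d.+1 (K j) w1`_0 (D j)) ->
  result (compose1M m d.+1 (trunc d.+1 (b0 *: w2)) (trunc d.+1 w1) D) =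
    mkseq (fun n => taylor n
      (fun s => \sum_(j < m) (b0 * w2.[s]) ^+ j * K j w1.[s])) d.+1.
Proof.
move=> m_gt0 KD.
pose P j := \poly_(l < d.+1) (D j l / l`!%:R).
have DP j l : (l <= d)%N -> D j l = (P j)`_l *+ l`!.
  move=> le_ld; rewrite coef_poly ltnS le_ld -[RHS]mulr_natr.
  by rewrite divfK // pnatr_eq0 -lt0n fact_gt0.
pose C j := P j \Po (w1 - (w1`_0)%:P).
have -> : result (compose1M m d.+1 (trunc d.+1 (b0 *: w2)) (trunc d.+1 w1) D) =
    trunc d.+1 (\sum_(j < m) C j * (b0 *: w2) ^+ j).
  rewrite -hornerM_result //= mapM_result; congr (result (Defs.hornerM _ _ _)).
  by apply: eq_map => j; rewrite (tableM_result w1 (DP j)).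
apply/eq_in_map => n; rewrite mem_iota ltnS => /andP[_ le_nd].
symmetry; apply: taylor_jet le_nd.
apply: (jet_sum (f := fun j s => (b0 * w2.[s]) ^+ j * K j w1.[s])
  (p := fun j => C j * (b0 *: w2) ^+ j)) => j ltjm.
rewrite [C j * _]mulrC; apply: jetM.
  have -> : (fun s => (b0 * w2.[s]) ^+ j) = fun s => (b0 *: w2).[s] ^+ j.
    by apply/funext => s; rewrite hornerZ.
  by apply: jetX; exact: jet_horner.
by apply: jet_comp; apply: derivatives_at_jet (KD _ ltjm) (DP j).
Qed.

End Results.

(** * Number of operations *)

Section Costs.
Variable R : realType.
Implicit Types (m k d n i N : nat).
Local Open Scope nat_scope.

Lemma ops_bind A B (sA : Stored A) (c : prog A) (f : A -> prog B) :
  ops (bind c f) = ops c + ops (f (result c)).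
Proof. by []. Qed.

Lemma mapM_ops A B (sB : Stored B) (f : A -> prog B) s :
  ops (mapM f s) = \sum_(x <- s) ops (f x).
Proof.
elim: s => [|x s IHs] /=; first by rewrite big_nil.
by rewrite big_cons IHs addn0.
Qed.

Lemma mapM_ops_const c A B (sB : Stored B) (f : A -> prog B) s :
  (forall x, ops (f x) = c) -> ops (mapM f s) = size s * c.
Proof.
move=> fc; rewrite mapM_ops (eq_bigr (fun=> c)) //.
by rewrite big_const_seq count_predT iter_addn_0 mulnC.
Qed.

Lemma loopM_ops I A (sA : Stored A) (f : I -> A -> prog A) (c : I -> nat) s x :
  (forall a y, ops (f a y) = c a) -> ops (loopM f s x) = \sum_(a <- s) c a.
Proof.
move=> fc; elim: s x => [|a s IHs] x /=; first by rewrite big_nil.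
by rewrite big_cons IHs fc.
Qed.

Lemma dotM_ops n (f g : nat -> R) : ops (dotM n f g) = n.*2.+1.
Proof.
rewrite /dotM /= (@loopM_ops _ _ _ _ (fun=> 2)) // big_const_seq count_predT.
by rewrite size_iota iter_addn_0 mul2n.
Qed.

Lemma paddM_ops N (p q : seq R) : ops (paddM N p q) = N.
Proof. by rewrite (@mapM_ops_const 1) // size_iota muln1. Qed.

Lemma pscaleM_ops N (c : R) p : ops (pscaleM N c p) = N.
Proof. by rewrite (@mapM_ops_const 1) // size_iota muln1. Qed.

Lemma pderivM_ops N (p : seq R) : ops (pderivM N p) = N.
Proof. by rewrite (@mapM_ops_const 1) // size_iota muln1. Qed.

Lemma pmulM_ops N (p q : seq R) : ops (pmulM N p q) = N ^ 2.
Proof.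
rewrite mapM_ops (eq_bigr (fun n => n.*2.+1)); last first.
  by move=> n _; rewrite dotM_ops.
rewrite -{1}[N]subn0 -/(index_iota 0 N).
elim: N => [|N IHN]; first by rewrite big_geq.
by rewrite big_nat_recr //= IHN; lia.
Qed.

Definition row_cost d i : nat :=
  if i == 2 then 0 else i.-1 * ((d + 2 - i) ^ 2 + 3 * (d + 2 - i)).

Lemma table_rowM_ops d (dq : seq R) i prev :
  ops (table_rowM d dq i prev) = row_cost d i.
Proof.
rewrite /table_rowM /row_cost; case: eqP => // _.
rewrite /= addn0 (@mapM_ops_const ((d + 2 - i) ^ 2 + 3 * (d + 2 - i))).
  by rewrite size_iota.
move=> j /=.
by rewrite pderivM_ops pmulM_ops paddM_ops pscaleM_ops; lia.
Qed.

Definition table_cost d : nat :=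
  d + (d.*2.+1 + \sum_(i <- iota 2 d) (row_cost d i + d.*2.+1)).

Lemma tableM_ops d (q : seq R) D : ops (tableM d q D) = table_cost d.
Proof.
rewrite /tableM ops_bind pderivM_ops ops_bind dotM_ops ops_bind addn0.
rewrite /table_cost; do 2 congr addn; apply: loopM_ops => i st.
by rewrite ops_bind table_rowM_ops ops_bind dotM_ops addn0.
Qed.

Lemma hornerM_ops k (V : seq R) Ps :
  ops (Defs.hornerM k V Ps) = (size Ps).-1 * (k ^ 2 + k).
Proof.
rewrite /Defs.hornerM -size_rev; case: (rev Ps) => //= H0 rest.
rewrite (@loopM_ops _ _ _ _ (fun=> k ^ 2 + k)); last first.
  by move=> P H /=; rewrite pmulM_ops paddM_ops.
by rewrite big_const_seq count_predT iter_addn_0 mulnC.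
Qed.

Lemma compose1M_ops m k (V w : seq R) D :
  ops (compose1M m k V w D) = m * table_cost k.-1 + m.-1 * (k ^ 2 + k).
Proof.
rewrite /compose1M ops_bind hornerM_ops mapM_result size_map size_iota.
rewrite (@mapM_ops_const (table_cost k.-1)) ?size_iota // => j.
exact: tableM_ops.
Qed.

Lemma composeM_ops m k (b0 : R) w1 w2 D : ops (composeM m k b0 w1 w2 D) =
  k + 2 * (m * table_cost k.-1 + m.-1 * (k ^ 2 + k)).
Proof.
rewrite /composeM ops_bind pscaleM_ops ops_bind compose1M_ops.
by rewrite ops_bind compose1M_ops addn0 mul2n addnn.
Qed.

(** The cost of the entries of a table if the second row were computed by the
   recursion like the others.  The closed form follows by induction on [d]: from
   [d] to [d.+1] the sum grows by the cost of one column, which has a closed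
   form as well. *)
Lemma sum_entry_costs d :
  12 * \sum_(n < d) n.+1 * ((d - n) ^ 2 + 3 * (d - n)) =
    d * d.+1 * d.+2 * (d + 7).
Proof.
have sumQ e : 3 * \sum_(n < e) ((e - n) ^ 2 + 3 * (e - n)) = e * e.+1 * (e + 5).
  elim: e => [|e IHe]; first by rewrite big_ord0.
  rewrite big_ord_recl subn0 mulnDr.
  have -> : \sum_(n < e) ((e.+1 - lift ord0 n) ^ 2 + 3 * (e.+1 - lift ord0 n))
    = \sum_(n < e) ((e - n) ^ 2 + 3 * (e - n)) by apply: eq_bigr.
  by rewrite IHe; lia.
elim: d => [|d IHd]; first by rewrite big_ord0.
rewrite big_ord_recl subn0 mulnDr.
have -> : \sum_(n < d) (lift ord0 n).+1 *
      ((d.+1 - lift ord0 n) ^ 2 + 3 * (d.+1 - lift ord0 n))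
    = \sum_(n < d) n.+1 * ((d - n) ^ 2 + 3 * (d - n)) +
      \sum_(n < d) ((d - n) ^ 2 + 3 * (d - n)).
  rewrite -big_split; apply: eq_bigr => n _ /=.
  by rewrite /bump /= add1n subSS; lia.
by move: IHd (sumQ d) => /=; lia.
Qed.

(** The second row is free, but the [d ^ 2 + 3 * d] operations missing from
   [sum_entry_costs] are outweighed by the [d.*2.+1] operations that each row
   requires for its coefficient of the composition. *)
Lemma table_cost_ge d : d.+1 ^ 4 <= 12 * table_cost d.
Proof.
have sum_rows : \sum_(i <- iota 2 d) (row_cost d i + d.*2.+1) =
    \sum_(n < d) row_cost d n.+2 + d * d.*2.+1.
  rewrite (iotaDl 2 0) big_map big_split /=; congr addn.
    by rewrite -[d in iota 0 d]subn0 -/(index_iota 0 d) big_mkord.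
  by rewrite big_const_seq count_predT size_iota iter_addn_0 mulnC.
have rows_ge : \sum_(n < d) n.+1 * ((d - n) ^ 2 + 3 * (d - n)) <=
    \sum_(n < d) row_cost d n.+2 + (d ^ 2 + 3 * d).
  case: (d) => [|e]; first by rewrite big_ord0.
  rewrite !big_ord_recl subn0 addnC leq_add //; last by rewrite mul1n.
  apply: leq_trans (leq_addl _ _); apply: leq_sum => n _.
  by rewrite /row_cost /= addn2.
by rewrite /table_cost sum_rows; move: rows_ge (sum_entry_costs d); lia.
Qed.

(** At most [d] rows, of at most [d] entries, of [O(d ^ 2)] operations each. *)
Lemma table_cost_le d : table_cost d <= 10 * d.+1 ^ 4.
Proof.
have rowle i : 2 <= i < d + 2 -> row_cost d i + d.*2.+1 <= 7 * d.+1 ^ 3.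
  move=> i_bd; rewrite /row_cost; case: ifP => _; first nia.
  suff : i.-1 * ((d + 2 - i) ^ 2 + 3 * (d + 2 - i)) <=
      d.+1 * (d.+1 ^ 2 + 3 * d.+1).
    by nia.
  by apply: leq_mul; [lia | apply: leq_add; [rewrite leq_exp2r | ]; lia].
have : \sum_(i <- iota 2 d) (row_cost d i + d.*2.+1) <= d * (7 * d.+1 ^ 3).
  have -> : d * (7 * d.+1 ^ 3) = \sum_(i <- iota 2 d) 7 * d.+1 ^ 3.
    by rewrite big_const_seq count_predT size_iota iter_addn_0 mulnC.
  rewrite big_seq [leqRHS]big_seq.
  by apply: leq_sum => i; rewrite mem_iota addnC => /rowle; rewrite addnC.
rewrite /table_cost; nia.
Qed.

End Costs.

(** * Storage *)

Section Space.
Variable R : realType.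
Implicit Types (m k d i N : nat).
Local Open Scope nat_scope.

Lemma ncoefs_seq (s : seq R) : ncoefs s = size s.
Proof.
by rewrite /ncoefs /stored_seq; elim: s => //= x s ->; rewrite add1n.
Qed.

Lemma le_peak_bind_first n A B (sA : Stored A) (c : prog A) (f : A -> prog B) :
  n <= peak c -> n <= peak (bind c f).
Proof. by rewrite leq_max => ->. Qed.

Lemma le_peak_bind_next n A B (sA : Stored A) (c : prog A) (f : A -> prog B) :
  n <= ncoefs (result c) + peak (f (result c)) -> n <= peak (bind c f).
Proof. by rewrite leq_max orbC => ->. Qed.

Lemma le_peak_bind_after n A B (sA : Stored A) (c : prog A) (f : A -> prog B) :
  n <= peak (f (result c)) -> n <= peak (bind c f).
Proof.
by move=> le_n; apply: le_peak_bind_next; apply: leq_trans le_n (leq_addl _ _).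
Qed.

Lemma le_peak_bind_stored n A B (sA : Stored A) (c : prog A) (f : A -> prog B) :
  n <= ncoefs (result c) -> n <= peak (bind c f).
Proof.
by move=> le_n; apply: le_peak_bind_next; apply: leq_trans le_n (leq_addr _ _).
Qed.

Lemma le_peak_loopM (I : eqType) A (sA : Stored A) (f : I -> A -> prog A)
    s x a c :
  a \in s -> (forall y, c <= peak (f a y)) -> c <= peak (loopM f s x).
Proof.
move=> a_s fc; elim: s a_s x => //= a' s IHs.
rewrite inE => /orP[/eqP<- | a_s] x.
  rewrite leq_max; apply/orP; left.
  exact: leq_trans (fc x) (leq_addl _ _).
by rewrite leq_max IHs ?orbT.
Qed.

Lemma size_mapM_result A B (sB : Stored B) (f : A -> prog B) s :
  size (result (mapM f s)) = size s.
Proof. by rewrite mapM_result size_map. Qed.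

Lemma ncoefs_table_row d (dq : seq R) i prev : 1 < i -> size dq = d ->
  ncoefs (result (table_rowM d dq i prev)) = i.-1 * (d + 2 - i).
Proof.
move=> i_gt1 dq_d; rewrite /table_rowM; case: eqP => [->|_].
  by rewrite -[LHS]/(0 + (ncoefs dq + 0)) ncoefs_seq dq_d; lia.
set entries := mapM _ _.
rewrite -[LHS]/(sumn (map ncoefs (result entries))) mapM_result -map_comp.
rewrite -[i.-1 in RHS](size_iota 2); elim: (iota 2 _) => //= j s ->.
by rewrite ncoefs_seq size_mapM_result size_iota.
Qed.

(** Row [a.+1] alone takes up this space once it is computed. *)
Lemma peak_tableM_ge d (q : seq R) D a : 0 < a <= d ->
  a * (d.+1 - a) <= peak (tableM d q D).
Proof.
move=> a_bd; rewrite /tableM; do 2 apply: le_peak_bind_after.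
apply: le_peak_bind_first; apply: (@le_peak_loopM _ _ _ _ _ _ a.+1).
  by rewrite mem_iota; lia.
move=> st; apply: le_peak_bind_stored.
rewrite ncoefs_table_row ?size_mapM_result ?size_iota //; last lia.
by rewrite addn2 subSS.
Qed.

(** The middle row of the first table gives [k ^ 2 / 4] up to rounding.  The
   array [V], present at the same time, compensates for the rounding and covers
   the case [k = 1], where a table has no computed row. *)
Lemma peak_composeM_ge m k (b0 : R) w1 w2 D : 0 < m -> 0 < k ->
  k ^ 2 <= 4 * peak (composeM m k b0 w1 w2 D).
Proof.
case: m => // m _ k_gt0.
have peakV c : c <= peak (compose1M m.+1 k (result (pscaleM k b0 w2)) w1
    (fun j i => (D j i).1)) -> k + c <= peak (composeM m.+1 k b0 w1 w2 D).
  move=> le_c; apply: le_peak_bind_next.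
  rewrite ncoefs_seq size_mapM_result size_iota leq_add2l.
  exact: le_peak_bind_first.
case: (ltnP 1 k) => [k_gt1 | k_le1]; last first.
  by move: (peakV 0 isT); move: (peak _) => space; nia.
have a_bd : 0 < k./2 <= k.-1 by lia.
have : k + k./2 * (k - k./2) <= peak (composeM m.+1 k b0 w1 w2 D).
  apply: peakV; rewrite -[X in X - _]prednK //.
  do 2 apply: le_peak_bind_first.
  exact: peak_tableM_ge a_bd.
nia.
Qed.

End Space.

(** * The composition *)

Section Composition.
Variable R : realType.
Implicit Types (m k j : nat) (b theta : R) (F K : nat -> R -> R * R).

Lemma series2E n c F theta s : series2 n c F theta s =
  (\sum_(j < n) (c * s) ^+ j * (F j theta).1,
   \sum_(j < n) (c * s) ^+ j * (F j theta).2).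
Proof.
rewrite /series2; elim: n => [|n IHn]; first by rewrite !big_ord0.
by rewrite !big_ord_recr IHn.
Qed.

Lemma horner_coef_scaled n b (c : nat -> R) s :
  (\poly_(j < n) (c j * b ^+ j)).[s] = \sum_(j < n) (b * s) ^+ j * c j.
Proof.
by rewrite horner_poly; apply: eq_bigr => j _; rewrite exprMn -mulrA mulrC.
Qed.

(** Nothing but the values at [theta] of the coefficients [F j] enters here, so
   the same statement serves for the series [W] and for the delayed one. *)
Lemma composeM_result m k b0 b F K theta D : (0 < m)%N -> (0 < k)%N ->
    (forall j, (j < m)%N ->
      derivatives_at k (fun x => (K j x).1) (F 0%N theta).1
        (fun i => (D j i).1) /\
      derivatives_at k (fun x => (K j x).2) (F 0%N theta).1
        (fun i => (D j i).2)) ->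
  result (composeM m k b0 (coefs1 k b F theta) (coefs2 k b F theta) D) =
    (mkseq (fun n => taylor n
       (fun s => (Kfun m b0 K (series2 k b F theta s)).1)) k,
     mkseq (fun n => taylor n
       (fun s => (Kfun m b0 K (series2 k b F theta s)).2)) k).
Proof.
case: k => // d m_gt0 _ KD.
pose w1 := \poly_(j < d.+1) ((F j theta).1 * b ^+ j).
pose w2 := \poly_(j < d.+1) ((F j theta).2 * b ^+ j).
have w1E : coefs1 d.+1 b F theta = trunc d.+1 w1.
  apply/eq_in_map => j; rewrite mem_iota => /andP[_ ltj].
  by rewrite coef_poly ltj.
have w2E : coefs2 d.+1 b F theta = trunc d.+1 w2.
  apply/eq_in_map => j; rewrite mem_iota => /andP[_ ltj].
  by rewrite coef_poly ltj.
have w10 : w1`_0 = (F 0%N theta).1 by rewrite coef_poly mulr1.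
have seriesE s : series2 d.+1 b F theta s = (w1.[s], w2.[s]).
  by rewrite series2E !horner_coef_scaled.
have VE : result (pscaleM d.+1 b0 (trunc d.+1 w2)) = trunc d.+1 (b0 *: w2).
  by apply: pscaleM_result => i; exact: nth_trunc.
rewrite /composeM w1E w2E.
rewrite -[LHS]/(result (compose1M m d.+1
    (result (pscaleM d.+1 b0 (trunc d.+1 w2))) (trunc d.+1 w1)
    (fun j i => (D j i).1)),
  result (compose1M m d.+1
    (result (pscaleM d.+1 b0 (trunc d.+1 w2))) (trunc d.+1 w1)
    (fun j i => (D j i).2))) VE.
rewrite (@compose1M_result _ _ _ _ w1 w2 (fun j x => (K j x).1)) //; last first.
  by move=> j /KD[]; rewrite w10.
rewrite (@compose1M_result _ _ _ _ w1 w2 (fun j x => (K j x).2)) //; last first.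
  by move=> j /KD[]; rewrite w10.
by congr pair; apply: eq_mkseq => n; congr taylor; apply/funext => s;
  rewrite /Kfun series2E seriesE.
Qed.

Lemma composeM_ops_bounds m k b0 (w1 w2 : seq R) D : (0 < m)%N -> (0 < k)%N ->
  (m * k ^ 4 <= 6 * ops (composeM m k b0 w1 w2 D))%N /\
  (ops (composeM m k b0 w1 w2 D) <= 25 * (m * k ^ 4))%N.
Proof.
case: k => // d m_gt0 _; rewrite composeM_ops /=.
have := table_cost_ge d; have := table_cost_le d.
move: (table_cost d) => c cle cge.
have k_le : (d.+1 <= d.+1 ^ 4)%N by rewrite -{1}[d.+1]expn1 leq_pexp2l.
have k2_le : (d.+1 ^ 2 <= d.+1 ^ 4)%N by rewrite leq_pexp2l.
split; first by nia.
move: (d.+1 ^ 4)%N (d.+1 ^ 2)%N d.+1 cle cge k_le k2_le => e e2 k *; nia.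
Qed.

End Composition.

Theorem theorem5p2 (R : realType) :
  exists c1 c2 c3 : R, [/\ 0 < c1, 0 < c2 & 0 < c3] /\
  forall (m k : nat) (b0 b omega lambda : R) (r : R * R -> R)
         (K W : nat -> R -> R * R) (theta : R),
    (0 < m)%N -> (0 < k)%N -> 0 < b0 -> 0 < b -> 0 < omega -> lambda < 0 ->
    (forall x, 0 < r x) ->
    (forall j, (j < m)%N -> periodic1 (K j)) ->
    (forall j, (0 < j < k)%N -> periodic1 (W j)) ->
    periodic1 (fun x => W 0%N x - (x, 0)) ->
    let composition_claim (F : nat -> R -> R * R) : Prop :=
      forall D : nat -> nat -> R * R,
        (forall j, (j < m)%N ->
          derivatives_at k (fun x => (K j x).1) (F 0%N theta).1
            (fun i => (D j i).1) /\
          derivatives_at k (fun x => (K j x).2) (F 0%N theta).1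
            (fun i => (D j i).2)) ->
        let run :=
          composeM m k b0 (coefs1 k b F theta) (coefs2 k b F theta) D in
        let KF := fun s => Kfun m b0 K (series2 k b F theta s) in
        [/\ (result run).1 = mkseq (fun n => taylor n (fun s => (KF s).1)) k,
            (result run).2 = mkseq (fun n => taylor n (fun s => (KF s).2)) k,
            c1 * (m * k ^ 4)%:R <= (ops run)%:R <= c2 * (m * k ^ 4)%:R
          & c3 * (k ^ 2)%:R <= (peak run)%:R] in
    composition_claim W /\
    composition_claim (Wtilde_coef m k b0 b omega lambda r K W).
Proof.
exists 6^-1, 25, 4^-1; split; first by split; lra.
move=> m k b0 b omega lambda r K W theta m_gt0 k_gt0 _ _ _ _ _ _ _ _ claim.
suff claimP F : claim F by split; exact: claimP.
move=> D KD run KF.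
have runE := composeM_result b0 b m_gt0 k_gt0 KD.
have [ops_ge ops_le] := composeM_ops_bounds b0 (coefs1 k b F theta)
  (coefs2 k b F theta) D m_gt0 k_gt0.
have peak_ge := peak_composeM_ge b0 (coefs1 k b F theta) (coefs2 k b F theta) D
  m_gt0 k_gt0.
split; [by rewrite /run runE | by rewrite /run runE | |].
- apply/andP; split; last by rewrite -natrM ler_nat.
  by rewrite mulrC ler_pdivrMr ?ltr0n // mulrC -natrM ler_nat.
- by rewrite mulrC ler_pdivrMr ?ltr0n // mulrC -natrM ler_nat.
Qed.
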